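(* Let $1\leq r\leq n-1$. Among estimators of $\Sigma$ of the form $aS$ with $a\in\mathbb{R}$ a deterministic constant, the optimal one (i.e. the one minimizing the risk $E[\mathrm{tr}([aS\Sigma^+-I_p]^2)]$) is $\hat{\Sigma}_{\mathrm{HF1}}=\frac{n}{n+r}S$, with risk $$E\left[\mathrm{tr}\left(\big[\hat\Sigma_{\mathrm{HF1}}\Sigma^+-I_p\big]^2\right)\right]=p-\frac{(n-1)r}{n+r}.$$ In particular $\hat{\Sigma}_{\mathrm{HF1}}$ dominates $S$, which itself dominates $\frac{n}{n-1}S$.
   Context: Model: $X_1,\dots,X_n$ are i.i.d. from the $p$-dimensional normal distribution $N_p(\mu,\Sigma)$ with $\mu\in\mathbb{R}^p$ and $\Sigma$ (symmetric positive semidefinite) unknown, where $r=\mathrm{rk}\,\Sigma<\min(n,p)$. The sample mean is $\bar X=\frac1n\sum_{i=1}^n X_i$ and the sample covariance matrix is $S=\frac1n\sum_{i=1}^n (X_i-\bar X)(X_i-\bar X)^t$. $A^+$ denotes the Moore-Penrose pseudoinverse of a matrix $A$. The estimation of $\Sigma$ is under the invariant squared loss $L(\hat\Sigma,\Sigma)=\mathrm{tr}[(\hat\Sigma\Sigma^+-I_p)^2]$, and the risk is the expected loss. ''Dominates'' is in the usual decision-theoretic sense with respect to this risk: the risk of the dominating estimator is no larger for every $(\mu,\Sigma)$ with $\mathrm{rk}\,\Sigma=r$, and strictly smaller for at least one. *)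

(* Defs.v *)
From HB Require Import structures.
From mathcomp Require Import all_boot all_order all_algebra.
From mathcomp Require Import all_classical all_reals all_analysis.

Set Implicit Arguments.
Unset Strict Implicit.
Unset Printing Implicit Defensive.

Import Order.TTheory GRing.Theory Num.Theory.

Local Open Scope classical_set_scope.
Local Open Scope ring_scope.

(* The four Penrose equations; the transpose is the adjoint since R is real. *)
Definition is_pinv (R : realType) m n (A : 'M[R]_(m, n)) (B : 'M[R]_(n, m)) :=
  [/\ A *m B *m A = A, B *m A *m B = B,
      (A *m B)^T = A *m B & (B *m A)^T = B *m A].

Definition pinv (R : realType) m n (A : 'M[R]_(m, n)) : 'M[R]_(n, m) :=
  xget 0 [set B | is_pinv A B].

Lemma is_pinv_uniq (R : realType) m n (A : 'M[R]_(m, n)) B C :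
  is_pinv A B -> is_pinv A C -> B = C.
Proof.
move=> [ABA BAB sAB sBA] [ACA CAC sAC sCA].
have EA : A *m B = A *m C.
  by rewrite -sAB -{1}ACA -[A *m C *m A *m B]mulmxA trmx_mul sAB sAC mulmxA ABA.
have EB : B *m A = C *m A.
  by rewrite -sBA -{1}ACA -mulmxA mulmxA trmx_mul sBA sCA -mulmxA [A *m _]mulmxA ABA.
by rewrite -BAB EB -mulmxA EA mulmxA CAC.
Qed.

Lemma gram_unit (R : realType) m n (A : 'M[R]_(m, n)) :
  row_free A -> A *m A^T \in unitmx.
Proof.
move=> fA; rewrite -row_free_unit -kermx_eq0; apply/eqP/row_matrixP => i.
rewrite row0; set u := row i _.
have uG : u *m (A *m A^T) = 0 by rewrite /u -row_mul mulmx_ker row0.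
suff uA : u *m A = 0.
  by move/row_freeP: fA => [B AB]; rewrite -[u]mulmx1 -AB mulmxA uA mul0mx.
set v := u *m A.
have sq0 : v *m v^T = 0 by rewrite trmx_mul mulmxA -[v *m _]mulmxA uG mul0mx.
apply/rowP => j; rewrite [RHS]mxE.
have := congr1 (fun M : 'M[R]_1 => M 0 0) sq0; rewrite [RHS]mxE [LHS]mxE => /eqP.
rewrite psumr_eq0 => [/allP/(_ j)|k _]; last by rewrite [v^T _ _]mxE -expr2 sqr_ge0.
rewrite mem_index_enum => /(_ isT) /=.
by rewrite [v^T _ _]mxE -expr2 sqrf_eq0 => /eqP.
Qed.

Lemma pinvP (R : realType) m n (A : 'M[R]_(m, n)) : is_pinv A (pinv A).
Proof.
apply: (@xgetPex _ 0 [set B | is_pinv A B]).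
have [k [C [D [DE uD uC]]]] : exists k (C : 'M[R]_(m, k)) (D : 'M[R]_(k, n)),
    [/\ A = C *m D, D *m D^T \in unitmx & C^T *m C \in unitmx].
  exists (\rank A), (col_base A), (row_base A); split.
  - by rewrite mulmx_base.
  - exact/gram_unit/row_base_free.
  - rewrite -{2}[col_base A]trmxK; apply: gram_unit.
    by rewrite /row_free mxrank_tr; exact: col_base_full.
pose G := invmx (D *m D^T); pose H := invmx (C^T *m C).
have sG : G^T = G by rewrite /G trmx_inv trmx_mul trmxK.
have sH : H^T = H by rewrite /H trmx_inv trmx_mul trmxK.
exists (D^T *m G *m H *m C^T) => /=.
have AB : A *m (D^T *m G *m H *m C^T) = C *m H *m C^T.
  rewrite DE !mulmxA -[C *m D *m D^T]mulmxA -[C *m (D *m D^T) *m G]mulmxA.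
  by rewrite mulmxV // mulmx1.
have BA : D^T *m G *m H *m C^T *m A = D^T *m G *m D.
  rewrite DE !mulmxA -[D^T *m G *m H *m C^T *m C]mulmxA.
  by rewrite -[D^T *m G *m H *m (C^T *m C)]mulmxA mulVmx // mulmx1.
split.
- rewrite AB DE mulmxA -[C *m H *m C^T *m C]mulmxA.
  by rewrite -[C *m H *m (C^T *m C)]mulmxA mulVmx // mulmx1.
- rewrite BA !mulmxA -[D^T *m G *m D *m D^T]mulmxA.
  by rewrite -[D^T *m G *m (D *m D^T)]mulmxA mulVmx // mulmx1.
- by rewrite AB !trmx_mul trmxK sH mulmxA.
- by rewrite BA !trmx_mul trmxK sG mulmxA.
Qed.

Definition psd (R : realType) p (A : 'M[R]_p) :=
  A^T = A /\ forall u : 'cV[R]_p, 0 <= (u^T *m A *m u) 0 0.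

Definition covariance_of_rank (R : realType) p (r : nat) (Sigma : 'M[R]_p) :=
  psd Sigma /\ \rank Sigma = r.

(* Parametrized by the variance. The library's [normal_prob m 0] is not the
   point mass at [m], hence the case distinction. *)
Definition normal_law (R : realType) (m v : R) (A : set R) : \bar R :=
  if v == 0 then dirac m A else normal_prob m (Num.sqrt v) A.

(* The library has a sigma-algebra on tuples (generated by the coordinates)
   but none on matrices. *)
Definition col_of_tuple (R : realType) p (x : p.-tuple R) : 'cV[R]_p :=
  \col_k tnth x k.

(* N_p(mu, Sigma), with Sigma possibly singular: every linear form u^T x has
   law N(u^T mu, u^T Sigma u). *)
Definition is_mvnormal (R : realType) p (nu : set (p.-tuple R) -> \bar R)
    (mu : 'cV[R]_p) (Sigma : 'M[R]_p) :=
  forall (u : 'cV[R]_p) (A : set R), measurable A ->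
    nu [set x | A ((u^T *m col_of_tuple x) 0 0)] =
    normal_law ((u^T *m mu) 0 0) ((u^T *m Sigma *m u) 0 0) A.

Definition mutually_independent d d' (T : measurableType d)
    (T' : measurableType d') (R : realType) (P : probability T R) n
    (X : 'I_n -> {mfun T >-> T'}) :=
  forall B : 'I_n -> set T', (forall i, measurable (B i)) ->
    fine (P [set w | forall i, B i (X i w)]) =
    \prod_(i < n) fine (P (X i @^-1` B i)).

Definition iid_mvnormal d (T : measurableType d) (R : realType)
    (P : probability T R) n p (X : 'I_n -> {mfun T >-> p.-tuple R})
    (mu : 'cV[R]_p) (Sigma : 'M[R]_p) :=
  (forall i, is_mvnormal (distribution P (X i)) mu Sigma) /\
  mutually_independent P X.

Definition sample_mean (R : realType) n p (x : 'I_n -> 'cV[R]_p) : 'cV[R]_p :=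
  n%:R^-1 *: \sum_(i < n) x i.

Definition sample_cov (R : realType) n p (x : 'I_n -> 'cV[R]_p) : 'M[R]_p :=
  n%:R^-1 *: \sum_(i < n) (x i - sample_mean x) *m (x i - sample_mean x)^T.

Definition estimator (R : realType) n p := ('I_n -> 'cV[R]_p) -> 'M[R]_p.

Definition scaled_cov (R : realType) n p (a : R) : estimator R n p :=
  fun x => a *: sample_cov x.

Definition loss (R : realType) p (Sigmahat Sigma : 'M[R]_p) : R :=
  \tr ((Sigmahat *m pinv Sigma - 1%:M) ^+ 2).

Section Risk.
Variables (d : measure_display) (T : measurableType d) (R : realType).
Variables (n p : nat).
(* The observations X are fixed maps on T; the law P mu Sigma varies with the
   unknown parameter. *)
Variable P : 'cV[R]_p -> 'M[R]_p -> probability T R.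
Variable X : 'I_n -> {mfun T >-> p.-tuple R}.

Definition normal_model (r : nat) := forall mu Sigma,
  covariance_of_rank r Sigma -> iid_mvnormal (P mu Sigma) X mu Sigma.

Definition risk (delta : estimator R n p) mu Sigma : \bar R :=
  'E_(P mu Sigma)[fun w => loss (delta (fun i => col_of_tuple (X i w))) Sigma].

Definition dominates (r : nat) (delta1 delta2 : estimator R n p) :=
  (forall mu Sigma, covariance_of_rank r Sigma ->
     (risk delta1 mu Sigma <= risk delta2 mu Sigma)%E) /\
  (exists mu Sigma, covariance_of_rank r Sigma /\
     (risk delta1 mu Sigma < risk delta2 mu Sigma)%E).

End Risk.

(* Main.v *)
(** Centring the observations as [Y_i = X_i - mu], the sample covariance is the
    quadratic expression [S = n^-1 sum_ij c_ij Y_i Y_j^T] with [c = I - J/n],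
    and the risk of [a S] is
    [a^2 E tr((S M)^2) - 2 a E tr(S M) + p] with [M] the pseudoinverse of
    [Sigma].  Wick's formula for products of two and of four linear forms in
    the [Y_i] turns both expectations into traces: only [tr c = tr c^2 = n - 1]
    and [tr (Sigma M) = tr (Sigma M Sigma M) = r] matter, and
    [E tr(S M) = (n-1) r / n], [E tr((S M)^2) = (n-1) r (n+r) / n^2].
    The risk is thus a quadratic polynomial in [a] with vertex [n / (n+r)].

    Wick's formula for a single index follows by polarization from the second
    and fourth moments of a univariate normal law, and for several indices by
    independence: an index occurring once contributes a factor of mean [0]. *)

Require Import Defs.
From HB Require Import structures.
From mathcomp Require Import all_boot all_order all_algebra.
From mathcomp Require Import all_classical all_reals all_analysis.
From mathcomp Require Import measurable_realfun.
From mathcomp Require Import ring lra zify.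

Set Implicit Arguments.
Unset Strict Implicit.
Unset Printing Implicit Defensive.

Import Order.TTheory GRing.Theory Num.Theory.
Import numFieldNormedType.Exports.

Local Open Scope classical_set_scope.
Local Open Scope ring_scope.

(** * Moments of the weight exp(-x^2) and of univariate normal laws *)

Section gauss_moments.
Variable R : realType.
Local Notation mu := (@lebesgue_measure R).

Definition gauss_mom (k : nat) (x : R) : R := x ^+ k * gauss_fun x.

Lemma continuous_gauss_mom k : continuous (gauss_mom k).
Proof.
move=> x; rewrite /gauss_mom; apply: cvgM; first exact: exprn_continuous.
exact: continuous_gauss_fun.
Qed.

Lemma gauss_mom_ge0 k x : ~~ odd k -> 0 <= gauss_mom k x.
Proof. by move=> ek; rewrite mulr_ge0 ?gauss_fun_ge0 ?exprn_even_ge0. Qed.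

Lemma is_derive_gauss_fun (x : R) :
  is_derive x 1 (fun y : R => - (gauss_fun y / 2)) (gauss_mom 1 x).
Proof.
rewrite /gauss_mom /gauss_fun.
apply: is_derive_eq.
by rewrite /GRing.scale /=; field.
Qed.

(** These are the boundary terms of the integration by parts below. With N = n + 1, one term of the
    exponential series bounds exp(N^2) below by N^(2k+4) / (k+2)!, so the value at N is at most
    (k+2)! / N. *)
Lemma gauss_mom_cvg0 k : gauss_mom k.+1 n.+1%:R @[n --> \oo] --> (0 : R).
Proof.
apply: (@squeeze_cvgr _ _ _ _ (cst 0) (fun n => k.+2`!%:R * harmonic n)).
- near=> n; rewrite /= mulr_ge0 ?exprn_ge0 ?gauss_fun_ge0 //=.
  rewrite /gauss_mom /gauss_fun expRN ler_pdivrMr ?expR_gt0 //.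
  have n0 : (0 : R) < n.+1%:R by rewrite ltr0n.
  have := @expR_ge1Dxn R (n.+1%:R ^+ 2) k.+1 (exprn_ge0 _ (ltW n0)).
  set N : R := n.+1%:R in n0 *; move=> h.
  have f0 : (0 : R) < k.+2`!%:R by rewrite ltr0n fact_gt0.
  apply: (@le_trans _ _ ((k.+2`!%:R * N^-1) * ((N ^+ 2) ^+ k.+2 / k.+2`!%:R))).
    have -> : (N ^+ 2) ^+ k.+2 = N * N ^+ (k.+1 + k.+2).
      by rewrite -exprM -exprS; congr (_ ^+ _); lia.
    have cancel (x y z : R) : x != 0 -> y != 0 -> y * x^-1 * (x * z / y) = z.
      by move=> x0 y0; field; rewrite x0 y0.
    rewrite cancel ?gt_eqF //.
    rewrite ler_weXn2l //.
      by rewrite /N ler1n.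
    by rewrite leq_addr.
  rewrite ler_wpM2l //; first by rewrite mulr_ge0 ?invr_ge0 ?ltW.
  by apply: le_trans h; rewrite lerDr.
- exact: cvg_cst.
- rewrite -(mulr0 (k.+2`!%:R : R)); apply: cvgM; first exact: cvg_cst.
  exact: cvg_harmonic.
Unshelve. all: end_near. Qed.

Definition half_mom k := (\int[mu]_(x in `[0%R, +oo[) (gauss_mom k x)%:E)%E.

(** Integration by parts on [0, N] differentiates x^(k+1) and integrates x exp(-x^2); then N goes to
    infinity, with monotone convergence on both sides. *)
Lemma half_momSS k : ~~ odd k -> half_mom k \is a fin_num ->
  half_mom k.+2 = ((k.+1%:R / 2)%:E * half_mom k)%E.
Proof.
move=> ek fk.
have mg j : measurable_fun setT (gauss_mom j).
  by apply: continuous_measurable_fun; exact: continuous_gauss_mom.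
have c1 := @ge0_cvgn_integral R mu _ (fun x => @gauss_mom_ge0 k x ek) (mg k).
have ek2 : ~~ odd k.+2 by rewrite /= negbK.
have c2 := @ge0_cvgn_integral R mu _ (fun x => @gauss_mom_ge0 k.+2 x ek2) (mg k.+2).

have ibp n : (\int[mu]_(x in `[0%R, n.+1%:R]) (gauss_mom k.+2 x)%:E =
    (- (gauss_mom k.+1 n.+1%:R / 2))%:E +
    (k.+1%:R / 2)%:E * \int[mu]_(x in `[0%R, n.+1%:R]) (gauss_mom k x)%:E)%E.
  have n0 : (0 : R) < n.+1%:R by rewrite ltr0n.
  have cX : continuous (fun y : R => y ^+ k.+1) by exact: exprn_continuous.
  have cG : continuous (fun y : R => - (gauss_fun y / 2)).
    by move=> x; apply: cvgN; apply: cvgMr_tmp; exact: continuous_gauss_fun.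
  have bd (f : R -> R) : continuous f -> (forall x, derivable f x 1) ->
      derivable_oo_LRcontinuous f 0 n.+1%:R.
    move=> cf df; split; first by move=> x _; exact: df.
      by apply: cvg_at_right_filter; exact: cf.
    by apply: cvg_at_left_filter; exact: cf.
  have := @integration_by_parts R (fun y : R => y ^+ k.+1)
    (fun y => - (gauss_fun y / 2)) (fun y => k.+1%:R * y ^+ k) (gauss_mom 1)
    0 n.+1%:R n0.
  have h1 : {within `[0, n.+1%:R], continuous (fun y : R => k.+1%:R * y ^+ k)}.
    apply: continuous_subspaceT => x; apply: cvgM; first exact: cvg_cst.
    exact: exprn_continuous.
  move=> /(_ h1 (bd _ cX (fun x => @exprn_derivable R _ x 1))).
  have h2 : {in `]0, n.+1%:R[, derive1 (fun y : R => y ^+ k.+1) =1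
                                fun y => k.+1%:R * y ^+ k}.
    by move=> x _; rewrite exp_derive1.
  have h3 : {within `[0, n.+1%:R], continuous (gauss_mom 1)}.
    by apply: continuous_subspaceT; exact: continuous_gauss_mom.
  have dG x := @ex_derive _ _ _ _ _ _ _ (is_derive_gauss_fun x).
  move=> /(_ h2 h3 (bd _ cG dG)).
  have h4 : {in `]0, n.+1%:R[,
      derive1 (fun y : R => - (gauss_fun y / 2)) =1 gauss_mom 1}.
    by move=> x _; rewrite derive1E; apply: derive_val; exact: is_derive_gauss_fun.
  move=> /(_ h4) ibp.
  transitivity (\int[mu]_(x in `[0%R, n.+1%:R]) (x ^+ k.+1 * gauss_mom 1 x)%:E)%E.
    by apply: eq_integral => x _; rewrite /gauss_mom expr1 mulrA -exprSr.
  rewrite {}ibp expr0n /= mul0r subr0 mulrN mulrA -/(gauss_mom _ _).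
  congr (_ + _)%E.
  have ig : mu.-integrable `[0%R, n.+1%:R] (EFin \o gauss_mom k).
    apply: continuous_compact_integrable; first exact: segment_compact.
    by apply: continuous_subspaceT; exact: continuous_gauss_mom.
  rewrite -[RHS]oppeK -mulNe -EFinN -integralZl //=; congr (- _)%E.
  by apply: eq_integral => x _; rewrite -EFinM /gauss_mom; congr EFin; ring.
(* [ibp] is stated at n + 1, where the interval is nondegenerate, so the sequences are shifted by
   one. *)
apply: (cvg_unique _ c2) => //=; rewrite -cvg_shiftS /=.
under eq_fun do rewrite ibp.
rewrite -(add0e (_ * half_mom k)%E); apply: cvgeD => //.
- apply: cvg_EFin; first by near=> n.
  rewrite /= -oppr0; apply: cvgN; rewrite -(mul0r 2^-1); apply: cvgMr_tmp.
  exact: gauss_mom_cvg0.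
- apply: cvgeZl => //.
  by move: c1; rewrite -cvg_shiftS.
Unshelve. all: by end_near. Qed.

Lemma integralT_gauss_mom k : ~~ odd k ->
  (\int[mu]_x (gauss_mom k x)%:E)%E = (2%:E * half_mom k)%E.
Proof.
move=> ek; rewrite ge0_symfun_integralT.
- by rewrite -set_itvcy.
- by move=> x; exact: gauss_mom_ge0.
- exact: continuous_gauss_mom.
- move=> x; rewrite /gauss_mom /gauss_fun /= sqrrN exprNn -signr_odd (negbTE ek).
  by rewrite mul1r.
Qed.

Lemma half_mom0 : half_mom 0 = (Num.sqrt pi / 2)%:E.
Proof.
rewrite -integral0y_gauss; apply: eq_integral => x _.
by rewrite /gauss_mom expr0 mul1r.
Qed.

Lemma integralT_gauss_mom2 :
  (\int[mu]_x (gauss_mom 2 x)%:E)%E = (Num.sqrt pi / 2)%:E.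
Proof.
rewrite integralT_gauss_mom // half_momSS // half_mom0 // -!EFinM.
by congr EFin; field.
Qed.

Lemma integralT_gauss_mom4 :
  (\int[mu]_x (gauss_mom 4 x)%:E)%E = (3 * Num.sqrt pi / 4)%:E.
Proof.
rewrite integralT_gauss_mom // half_momSS // half_momSS // half_mom0 // -!EFinM.
by congr EFin; field.
Qed.


(** The Radon-Nikodym derivative of [normal_prob] equals [normal_pdf] almost everywhere, since both
    have the same integral over every measurable set. *)
Lemma ge0_integral_normal_prob (m s : R) (f : R -> R) :
  measurable_fun setT f -> (forall x, 0 <= f x) ->
  (\int[normal_prob m s]_x (f x)%:E =
   \int[mu]_x (f x * normal_pdf m s x)%:E)%E.
Proof.
move=> mf f0; have dom := normal_prob_dominates m s.
have f0' x : (0 <= (f x)%:E)%E by rewrite lee_fin.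
have mf' : measurable_fun setT (EFin \o f) by exact/measurable_EFinP.
rewrite -(Radon_Nikodym_SigmaFinite.change_of_variables dom f0' measurableT mf').
under [RHS]eq_integral do rewrite EFinM.
apply: ae_eq_integral => //.
- apply: emeasurable_funM; first exact/measurable_EFinP.
  exact: measurable_int (Radon_Nikodym_SigmaFinite.f_integrable dom).
- apply: emeasurable_funM; apply/measurable_EFinP => //.
  exact: measurable_normal_pdf.
- apply: ae_eqe_mul2l; apply: integral_ae_eq => //=.
  + exact: Radon_Nikodym_SigmaFinite.f_integrable.
  + by apply/measurable_EFinP; exact: measurable_normal_pdf.
  + by move=> E _ mE; rewrite -Radon_Nikodym_SigmaFinite.f_integral.
Qed.

(** The substitution y = (x - m) / sqrt(2 s^2) turns the density into exp(-y^2) / sqrt(pi); the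
    square root is positive whatever the sign of s. *)
Lemma integral_normal_prob_std (m s : R) (h : R -> R) : s != 0 ->
  continuous h -> (forall x, 0 <= h x) ->
  (\int[normal_prob m s]_x (h ((x - m) / Num.sqrt (s ^+ 2 *+ 2)))%:E =
   ((Num.sqrt pi)^-1)%R%:E * \int[mu]_x (h x * gauss_fun x)%:E)%E.
Proof.
move=> s0 ch h0; set c := Num.sqrt (s ^+ 2 *+ 2).
have c0 : 0 < c by rewrite sqrtr_gt0 pmulrn_lgt0 // exprn_even_gt0.
have cV0 : 0 < c^-1 by rewrite invr_gt0.
have c2 : c ^+ 2 = s ^+ 2 *+ 2 by rewrite sqr_sqrtr // mulrn_wge0 // sqr_ge0.
have p0 : (0 : R) < Num.sqrt pi by rewrite sqrtr_gt0 pi_gt0.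
pose F (x : R^o) : R^o := (x - m) / c.
have cF : continuous F.
  move=> x; apply: cvgMr_tmp; apply: cvgB; [exact: cvg_id|exact: cvg_cst].
have F'E : derive1 F = cst c^-1.
  apply/funext => x; rewrite /F derive1E deriveM// deriveD// derive_cst scaler0.
  by rewrite add0r derive_id derive_cst addr0 scaler1.
have chg : continuous (fun x => h x * gauss_fun x).
  by move=> x; apply: cvgM; [exact: ch|exact: continuous_gauss_fun].
have mhF : measurable_fun setT (fun x : R => h ((x - m) / c)).
  apply: continuous_measurable_fun.
  by move=> x; apply: (continuous_comp (cF x)); exact: ch.
rewrite ge0_integral_normal_prob //.
rewrite (@increasing_ge0_integration_by_substitutionT R F
  (fun x => h x * gauss_fun x)).
- rewrite -ge0_integralZl //=; first last.
  - move=> x _; rewrite lee_fin F'E !mulr_ge0 ?gauss_fun_ge0 ?h0 // ltW //.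
  - apply/measurable_EFinP; rewrite F'E; apply: measurable_funM => //.
    apply: continuous_measurable_fun.
    by move=> x; apply: (continuous_comp (cF x)); exact: chg.
  apply: eq_integral => x _; rewrite F'E -EFinM; congr EFin.
  rewrite normal_pdfE // /normal_peak /normal_fun /gauss_fun /=.
  rewrite !fctE.
  have -> : - F x ^+ 2 = - (x - m) ^+ 2 / (s ^+ 2 *+ 2).
    by rewrite /F expr_div_n c2 -mulNr.
  have -> : Num.sqrt (s ^+ 2 * pi *+ 2) = c * Num.sqrt pi.
    by rewrite -sqrtrM ?mulrnAl // mulrn_wge0 // sqr_ge0.
  rewrite -/(F x); move: (expR _) (h _) => e y.
  by field; rewrite !gt_eqF.
- by move=> x y xy; rewrite /F ltr_pM2r // ltrD2r.
- by rewrite F'E => ?; exact: cvg_cst.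
- by rewrite F'E; exact: is_cvg_cst.
- by rewrite F'E; exact: is_cvg_cst.
- by move=> x; rewrite /F; apply: derivableM => //; apply: derivableB.
- by apply/gt0_cvgMlNy; last exact: cvg_addrr_Ny.
- by apply/gt0_cvgMly; last exact: cvg_addrr.
- exact: chg.
- by move=> x; rewrite mulr_ge0 ?h0 ?gauss_fun_ge0.
Qed.

Lemma normal_prob_even_mom (m s : R) k : ~~ odd k -> s != 0 ->
  (\int[normal_prob m s]_x ((x - m) ^+ k)%:E =
   (Num.sqrt (s ^+ 2 *+ 2) ^+ k / Num.sqrt pi)%:E *
   \int[mu]_x (gauss_mom k x)%:E)%E.
Proof.
move=> ek s0; set c := Num.sqrt (s ^+ 2 *+ 2).
have c0 : 0 < c by rewrite sqrtr_gt0 pmulrn_lgt0 // exprn_even_gt0.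
have ck : 0 <= c ^+ k by rewrite exprn_even_ge0.
transitivity (\int[normal_prob m s]_x (c ^+ k * ((x - m) / c) ^+ k)%:E)%E.
  apply: eq_integral => x _; congr EFin.
  by rewrite expr_div_n mulrC divfK // expf_neq0 // gt_eqF.
rewrite (@integral_normal_prob_std m s (fun y => c ^+ k * y ^+ k)) //; first last.
- by move=> x; rewrite mulr_ge0 // exprn_even_ge0.
- by move=> x; apply: cvgMl_tmp; exact: exprn_continuous.
rewrite mulrC EFinM -muleA; congr (_ * _)%E.
rewrite -ge0_integralZl //.
- by apply: eq_integral => x _; rewrite -EFinM /gauss_mom mulrA.
- apply/measurable_EFinP.
  exact: (continuous_measurable_fun (@continuous_gauss_mom k)).
- by move=> x _; rewrite lee_fin gauss_mom_ge0.
Qed.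

Lemma normal_prob_mom2 (m s : R) : s != 0 ->
  (\int[normal_prob m s]_x ((x - m) ^+ 2)%:E = (s ^+ 2)%:E)%E.
Proof.
move=> s0; rewrite normal_prob_even_mom // integralT_gauss_mom2 -EFinM.
rewrite sqr_sqrtr ?mulrn_wge0 ?sqr_ge0 //; congr EFin.
by field; rewrite gt_eqF // sqrtr_gt0 pi_gt0.
Qed.

Lemma normal_prob_mom4 (m s : R) : s != 0 ->
  (\int[normal_prob m s]_x ((x - m) ^+ 4)%:E = (3 * s ^+ 4)%:E)%E.
Proof.
move=> s0; rewrite normal_prob_even_mom // integralT_gauss_mom4 -EFinM.
rewrite (exprM _ 2 2) sqr_sqrtr ?mulrn_wge0 ?sqr_ge0 //; congr EFin.
by field; rewrite gt_eqF // sqrtr_gt0 pi_gt0.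
Qed.

Lemma ge0_integral_lebesgueN (f : R -> R) : measurable_fun setT f ->
  (forall x, 0 <= f x) ->
  (\int[mu]_x (f (- x))%:E = \int[mu]_x (f x)%:E)%E.
Proof.
move=> mf f0; rewrite [RHS](eq_measure_integral
  (pushforward mu (-%R : R -> measurableTypeR R))).
  rewrite ge0_integral_pushforward //; first exact/measurable_EFinP.
  by move=> x _; rewrite lee_fin.
by move=> A mA _; exact/esym/lebesgue_measureN.
Qed.

(* With [x - m] square integrable, this says that its mean vanishes. *)
Lemma normal_prob_reflect (m s : R) : s != 0 ->
  (\int[normal_prob m s]_x ((1 + (x - m)) ^+ 2)%:E =
   \int[normal_prob m s]_x ((1 - (x - m)) ^+ 2)%:E)%E.
Proof.
move=> s0; set c := Num.sqrt (s ^+ 2 *+ 2).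
have c0 : c != 0 by rewrite gt_eqF // sqrtr_gt0 pmulrn_lgt0 // exprn_even_gt0.
have csq (a b : R) : continuous (fun x => (a + b * x) ^+ 2).
  move=> x; apply: (@continuous_comp _ _ _ (fun x => a + b * x) (fun x => x ^+ 2)).
    by apply: cvgD; [exact: cvg_cst|apply: cvgMl_tmp; exact: cvg_id].
  exact: exprn_continuous.
have E (a : R) : (\int[normal_prob m s]_x ((1 + a * (x - m)) ^+ 2)%:E =
    ((Num.sqrt pi)^-1)%R%:E * \int[mu]_x ((1 + a * c * x) ^+ 2 * gauss_fun x)%:E)%E.
  rewrite -(@integral_normal_prob_std m s (fun x => (1 + a * c * x) ^+ 2)) //.
    apply: eq_integral => x _; congr ((1 + _) ^+ 2)%:E.
    by rewrite -/c -mulrA [c * _]mulrC divfK.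
  by move=> x; exact: sqr_ge0.
transitivity (\int[normal_prob m s]_x ((1 + 1 * (x - m)) ^+ 2)%:E)%E.
  by apply: eq_integral => x _; rewrite mul1r.
transitivity (\int[normal_prob m s]_x ((1 + -1 * (x - m)) ^+ 2)%:E)%E; last first.
  by apply: eq_integral => x _; rewrite mulN1r.
rewrite !E; congr (_ * _)%E.
(* [gauss_fun] is even, so x -> -x exchanges the coefficients 1 and -1. *)
rewrite -ge0_integral_lebesgueN.
- apply: eq_integral => x _; rewrite /gauss_fun sqrrN.
  by congr ((1 + _) ^+ 2 * _)%:E; ring.
- apply: measurable_funM; last exact: measurable_gauss_fun.
  by apply: continuous_measurable_fun; exact: csq.
- by move=> x; rewrite mulr_ge0 ?sqr_ge0 ?gauss_fun_ge0.
Qed.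

End gauss_moments.

(** * Means, and products of independent variables *)

Section mean.
Context d (T : measurableType d) (R : realType) (P : probability T R).

(* Integrability is part of the definition, since the integral of a function
   that is not integrable has a junk value. *)
Definition has_mean (f : T -> R) (e : R) :=
  P.-integrable setT (EFin \o f) /\ (\int[P]_w (f w)%:E = e%:E)%E.

Lemma has_mean_measurable f e : has_mean f e -> measurable_fun setT f.
Proof. by move=> [/measurable_int/measurable_EFinP]. Qed.

Lemma eq_has_mean f g e : f =1 g -> has_mean f e -> has_mean g e.
Proof. by move=> /funext ->. Qed.

Lemma has_mean_integrable f : P.-integrable setT (EFin \o f) ->
  exists e, has_mean f e.
Proof.
move=> fi; exists (fine (\int[P]_w (f w)%:E)); split => //.
by rewrite fineK //; exact: integrable_fin_num fi.
Qed.

Lemma has_mean_cst c : has_mean (cst c) c.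
Proof.
split; first exact: finite_measure_integrable_cst.
have := integral_cst P measurableT c%:E; rewrite /cst => ->.
by rewrite [X in (_ * X)%E](probability_setT P) mule1.
Qed.

Lemma has_meanD f g e e' : has_mean f e -> has_mean g e' ->
  has_mean (fun w => f w + g w) (e + e').
Proof.
move=> [fi fe] [gi ge]; split; first exact: (integrableD measurableT fi gi).
rewrite -[LHS]/(\int[P]_w ((EFin \o f) w + (EFin \o g) w))%E.
by rewrite integralD //= fe ge EFinD.
Qed.

Lemma has_meanZ k f e : has_mean f e -> has_mean (fun w => k * f w) (k * e).
Proof.
move=> [fi fe]; split; first exact: (integrableZl measurableT k fi).
by rewrite -[LHS]/(\int[P]_w (k%:E * (EFin \o f) w))%E integralZl //= fe EFinM.
Qed.

Lemma has_mean_sum (I : Type) (r : seq I) (f : I -> T -> R) (e : I -> R) :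
  (forall i, has_mean (f i) (e i)) ->
  has_mean (fun w => \sum_(i <- r) f i w) (\sum_(i <- r) e i).
Proof.
move=> fe; elim: r => [|i r ih].
  by rewrite big_nil; apply: (eq_has_mean _ (has_mean_cst 0)) => w; rewrite big_nil.
rewrite big_cons; apply: (eq_has_mean _ (has_meanD (fe i) ih)) => w.
by rewrite big_cons.
Qed.

(** The law of (U, V) agrees with the product of the two laws on rectangles, hence everywhere.
    Tonelli then gives integrability of the product, and Fubini its mean. *)
Lemma indep_has_meanM (U V : T -> R) u v :
  (forall A B, measurable A -> measurable B ->
    P (U @^-1` A `&` V @^-1` B) = (P (U @^-1` A) * P (V @^-1` B))%E) ->
  has_mean U u -> has_mean V v -> has_mean (fun w => U w * V w) (u * v).
Proof.
move=> UV hU hV.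
have mU := has_mean_measurable hU; have mV := has_mean_measurable hV.
pose U' : {mfun T >-> R} := mfun_Sub (mem_set mU).
pose V' : {mfun T >-> R} := mfun_Sub (mem_set mV).
have mZ : measurable_fun setT (fun w => (U w, V w)) by exact: measurable_fun_pair.
pose Z : {mfun T >-> (R * R)%type} := mfun_Sub (mem_set mZ).
pose m1 := distribution P U'; pose m2 := distribution P V'.
have m12 : forall A, measurable A -> (m1 \x m2)%E A = distribution P Z A.
  apply: product_measure_unique => A B mA mB; exact: UV.
pose g (z : R * R) : R := z.1 * z.2.
have mg : measurable_fun setT (EFin \o g).
  apply/measurable_EFinP; apply: measurable_funM.
  - exact: measurable_fst.
  - exact: measurable_snd.
have [Ui Ue] := hU; have [Vi Ve] := hV.
have Um : m1.-integrable setT EFin.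
  apply/integrableP; split; first exact/measurable_EFinP.
  rewrite ge0_integral_distribution //; last exact: measurableT_comp.
  by have /integrableP[] := Ui.
have Vm : m2.-integrable setT EFin.
  apply/integrableP; split; first exact/measurable_EFinP.
  rewrite ge0_integral_distribution //; last exact: measurableT_comp.
  by have /integrableP[] := Vi.
have eU : (\int[m1]_x x%:E = u%:E)%E by rewrite integral_distribution.
have eV : (\int[m2]_x x%:E = v%:E)%E by rewrite integral_distribution.
have ig : (m1 \x m2)%E.-integrable setT (EFin \o g).
  apply/integrable12ltyP => //.
  have fV : (\int[m2]_y `|y%:E| \is a fin_num)%E.
    by rewrite ge0_fin_numE ?integral_ge0 //; have /integrableP[] := Vm.
  have -> : (\int[m1]_x \int[m2]_y `|(EFin \o g) (x, y)| =
      \int[m1]_x (`|x%:E| * \int[m2]_y `|y%:E|))%E.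
    apply: eq_integral => x _; rewrite -ge0_integralZl //.
    - by apply: eq_integral => y _; rewrite /g /= normrM EFinM.
    - by apply: measurableT_comp => //; exact/measurable_EFinP.
  rewrite -(fineK fV) ge0_integralZr //.
  - rewrite fineK // lte_mul_pinfty ?integral_ge0 //.
      by rewrite ge0_fin_numE ?integral_ge0 //; have /integrableP[] := Um.
    by have /integrableP[] := Vm.
  - by apply: measurableT_comp => //; exact/measurable_EFinP.
  - by rewrite lee_fin fine_ge0 // integral_ge0.
have iZ : P.-integrable setT ((EFin \o g) \o Z).
  apply/integrableP; split; first exact: measurableT_comp mg _.
  rewrite -(@ge0_integral_distribution _ _ _ _ _ P Z
    (fun z => `|(EFin \o g) z|%E)) //; last exact: measurableT_comp.
  rewrite (eq_measure_integral (m1 \x m2)%E); last by move=> A mA _; exact/esym/m12.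
  by have /integrableP[] := ig.
split; first exact: iZ.
rewrite -[LHS]/(\int[P]_w (((EFin \o g) \o Z) w))%E -integral_distribution //.
rewrite (eq_measure_integral (m1 \x m2)%E); last by move=> A mA _; exact/esym/m12.
rewrite -integral12_prod_meas1 // /fubini_F.
transitivity (\int[m1]_x (v%:E * x%:E))%E.
  apply: eq_integral => x _; by rewrite -eV muleC -integralZl.
by rewrite integralZl // eU -EFinM mulrC.
Qed.
End mean.

(** * Independence of one observation from all the others *)

Section block_independence.
Context d d' (T : measurableType d) (T' : measurableType d') (R : realType).
Variables (P : probability T R) (n : nat) (X : 'I_n -> {mfun T >-> T'}).
Hypothesis indX : mutually_independent P X.

(* A pi-system generating the sigma-algebra of the [X m] with [m != i]. *)
Definition off_cylinders (i : 'I_n) : set (set T) :=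
  [set C | exists B : 'I_n -> set T', (forall m, measurable (B m)) /\
     C = [set w | forall m, m != i -> B m (X m w)]].

Lemma cylinder_measurable (Q : pred 'I_n) (B : 'I_n -> set T') :
  (forall m, measurable (B m)) ->
  measurable [set w | forall m, Q m -> B m (X m w)].
Proof.
move=> mB.
apply: (@fin_bigcap_measurable _ _ _ [set m | Q m] (fun m => X m @^-1` B m)).
  exact: finite_finset.
by move=> m _; rewrite -[_ @^-1` _]setTI; exact: measurable_funP.
Qed.

Lemma off_cylinders_setI i : setI_closed (off_cylinders i).
Proof.
move=> _ _ [B [mB ->]] [C [mC ->]].
exists (fun m => B m `&` C m); split; first by move=> m; exact: measurableI.
apply/seteqP; split => w /= => [[h1 h2] m mi|h]; last by split => m /h[].
by split; [exact: h1|exact: h2].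
Qed.

Lemma measurable_fun_off_cylinders i m : m != i ->
  measurable_fun [set: g_sigma_algebraType (off_cylinders i)] (X m).
Proof.
move=> mi _ B mB; rewrite setTI; apply: sub_sigma_algebra.
exists (fun k => if k == m then B else setT); split.
  by move=> k; case: ifP.
apply/seteqP; split => w /= => [h k _|/(_ m mi)]; last by rewrite eqxx.
by case: eqP => // ->.
Qed.


(** Mutual independence is applied to the family with D at i and B elsewhere. D = A gives the
    left-hand side, and D = [setT] shows that the remaining product is P C. *)
Lemma indep_off_cylinders i A C : measurable A -> off_cylinders i C ->
  P (X i @^-1` A `&` C) = (P (X i @^-1` A) * P C)%E.
Proof.
move=> mA [B [mB ->]].
have mB' D : measurable D -> forall m, measurable (if m == i then D else B m).
  by move=> mD m; case: ifP.
have prodE D : measurable D ->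
    P (X i @^-1` D `&` [set w | forall m, m != i -> B m (X m w)]) =
    (fine (P (X i @^-1` D)) * \prod_(m < n | m != i) fine (P (X m @^-1` B m)))%:E.
  move=> mD; have := indX (mB' D mD); rewrite (bigD1 i) //= eqxx.
  under eq_bigr => m mi do rewrite (negbTE mi).
  move=> <-; rewrite fineK ?fin_num_measure //; last first.
    have := @cylinder_measurable predT _ (mB' D mD).
    congr (measurable _); apply/seteqP; split => w /= h m => [|_]; exact: h.
  congr (P _); apply/seteqP; split => w /=.
    by move=> [h1 h2] m; case: eqP => [->//|/eqP]; exact: h2.
  move=> h; split; first by have := h i; rewrite eqxx.
  by move=> m mi; have := h m; rewrite (negbTE mi).
rewrite prodE // EFinM fineK ?fin_num_measure //; last first.
  by rewrite -[_ @^-1` _]setTI; exact: measurable_funP.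
congr (_ * _)%E.
have := prodE _ measurableT; rewrite preimage_setT setTI probability_setT /=.
by rewrite mul1r => ->.
Qed.

(** Both sides are finite measures in C that agree on a pi-system containing [setT], hence on the
    sigma-algebra it generates. *)
Lemma indep_g_off_cylinders i A C : measurable A -> <<s off_cylinders i >> C ->
  P (X i @^-1` A `&` C) = (P (X i @^-1` A) * P C)%E.
Proof.
move=> mA sC.
have mXA : measurable (X i @^-1` A).
  by rewrite -[_ @^-1` _]setTI; exact: measurable_funP.
have fA : (0 <= fine (P (X i @^-1` A)))%R by rewrite fine_ge0.
have e D : off_cylinders i D ->
    mrestr P mXA D = mscale (NngNum fA) P D.
  move=> oD; rewrite /mrestr /mscale /= setIC indep_off_cylinders //.
  by rewrite fineK // fin_num_measure.
have Gm : off_cylinders i `<=` measurable.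
  by move=> D [B [mB ->]]; exact: cylinder_measurable.
have GT (k : nat) : off_cylinders i setT.
  by exists (fun=> setT); split => //; apply/seteqP; split.
have cT : \bigcup_(k : nat) (setT : set T) = setT by rewrite bigcup_const.
have := g_sigma_algebra_measure_unique _ Gm _ GT cT _ _
  (@off_cylinders_setI i) e _ C sC.
move=> uniq; rewrite setIC -[LHS]/(mrestr P mXA C) uniq.
  rewrite -[LHS]/((fine (P (X i @^-1` A)))%:E * P C)%E fineK //.
  exact: fin_num_measure.
move=> _; apply: le_lt_trans (ltry 1); apply: probability_le1.
by apply: measurableI.
Qed.

(** V may depend jointly on all the X m with m != i; in this form one observation is split off a
    product. *)
Lemma off_indep_has_meanM i (f : T' -> R) (V : T -> R) u v :
  measurable_fun setT f ->
  measurable_fun [set: g_sigma_algebraType (off_cylinders i)] V ->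
  has_mean P (f \o X i) u -> has_mean P V v ->
  has_mean P (fun w => f (X i w) * V w) (u * v).
Proof.
move=> mf mV; apply: indep_has_meanM => A B mA mB.
have := @indep_g_off_cylinders i (f @^-1` A) (V @^-1` B).
apply.
  by rewrite -[_ @^-1` _]setTI; exact: mf.
by have := mV measurableT B mB; rewrite setTI.
Qed.

End block_independence.

(** * Integrability of products from fourth moments *)

Section fourth_power_integrable.
Context d (T : measurableType d) (R : realType) (P : probability T R).

Lemma ge0_has_mean (f : T -> R) e : measurable_fun setT f ->
  (forall w, 0 <= f w) -> (\int[P]_w (f w)%:E = e%:E)%E -> has_mean P f e.
Proof.
move=> mf f0 fe; split => //; apply/integrableP; split.
  exact/measurable_EFinP.
under eq_integral do rewrite /= ger0_norm ?f0 //.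
by rewrite fe ltry.
Qed.

Lemma le_has_mean (f g : T -> R) e : measurable_fun setT f ->
  (forall w, `|f w| <= g w) -> has_mean P g e -> exists e', has_mean P f e'.
Proof.
move=> mf fg [gi _]; apply: has_mean_integrable.
apply: le_integrable gi => //; first exact/measurable_EFinP.
by move=> w _; rewrite /= lee_fin (le_trans (fg w)) // ler_norm.
Qed.

Definition L4 (f : T -> R) :=
  measurable_fun setT f /\ exists e, has_mean P (fun w => f w ^+ 4) e.

Lemma L4_cst c : L4 (cst c).
Proof.
by split; [exact: measurable_cst|exists (c ^+ 4); exact: (has_mean_cst P (c ^+ 4))].
Qed.

(** The product is dominated by the sum of the fourth powers. Constants are in [L4], so filling up
    with [cst 1] covers fewer factors. *)
Lemma L4_mul4 (f g h k : T -> R) : L4 f -> L4 g -> L4 h -> L4 k ->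
  exists e, has_mean P (fun w => f w * g w * h w * k w) e.
Proof.
move=> [mf [a fa]] [mg [b gb]] [mh [c hc]] [mk [e ke]].
apply: (@le_has_mean _ (fun w => f w ^+ 4 + g w ^+ 4 + h w ^+ 4 + k w ^+ 4)
  (a + b + c + e)); last by do 3?apply: has_meanD.
- by do 3?apply: measurable_funM.
- move=> w; move: (f w) (g w) (h w) (k w) => x y z t; rewrite ler_norml.
  (* 2 |xyzt| <= (xy)^2 + (zt)^2 and 2 (xy)^2 <= x^4 + y^4, likewise for z and t. *)
  have := sqr_ge0 (x * y + z * t); have := sqr_ge0 (x * y - z * t).
  have := sqr_ge0 (x ^+ 2 - y ^+ 2); have := sqr_ge0 (z ^+ 2 - t ^+ 2).
  have := sqr_ge0 (x ^+ 2); have := sqr_ge0 (y ^+ 2).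
  have := sqr_ge0 (z ^+ 2); have := sqr_ge0 (t ^+ 2).
  by move=> *; apply/andP; split; nra.
Qed.

End fourth_power_integrable.

(** * Wick's formula for centred linear forms of a normal sample *)

Section normal_sample.
Context d (T : measurableType d) (R : realType) (P : probability T R).
Variables (n p : nat) (X : 'I_n -> {mfun T >-> p.-tuple R}).
Variables (mu : 'cV[R]_p) (Sigma : 'M[R]_p).
Hypothesis hX : iid_mvnormal P X mu Sigma.
Hypothesis hS : psd Sigma.

Definition centered_form (u : 'cV[R]_p) (x : p.-tuple R) : R :=
  (u^T *m (col_of_tuple x - mu)) 0 0.

Definition cov (u v : 'cV[R]_p) : R := (u^T *m Sigma *m v) 0 0.

Definition lin_mean (u : 'cV[R]_p) : R := (u^T *m mu) 0 0.

Lemma measurable_linear_form (u : 'cV[R]_p) :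
  measurable_fun setT (fun x : p.-tuple R => (u^T *m col_of_tuple x) 0 0).
Proof.
have -> : (fun x : p.-tuple R => (u^T *m col_of_tuple x) 0 0) =
    fun x => \sum_k u k 0 * tnth x k.
  by apply/funext => x; rewrite mxE; apply: eq_bigr => k _; rewrite !mxE.
apply: measurable_sum => k; apply: measurable_funM => //.
exact: measurable_tnth.
Qed.

Lemma centered_formE u x : centered_form u x = (u^T *m col_of_tuple x) 0 0 - (u^T *m mu) 0 0.
Proof. by rewrite /centered_form mulmxBr !mxE. Qed.

Lemma measurable_form u : measurable_fun setT (centered_form u).
Proof.
rewrite (_ : centered_form u =
  fun x => (u^T *m col_of_tuple x) 0 0 - (u^T *m mu) 0 0).
  by apply: measurable_funB => //; exact: measurable_linear_form.
by apply/funext => x; rewrite centered_formE.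
Qed.

Lemma measurable_formX u i : measurable_fun setT (fun w => centered_form u (X i w)).
Proof. by apply: measurableT_comp => //; exact: measurable_form. Qed.

Lemma cov_ge0 u : 0 <= cov u u.
Proof. by case: hS => _; exact. Qed.

(** Moments of a form reduce to one-dimensional integrals. For variance 0 the law is the point mass
    at the mean, so the centred form is almost surely 0. *)
Lemma integral_form u i (f : R -> R) :
  measurable_fun setT f -> (forall y, 0 <= f y) ->
  (\int[P]_w (f (centered_form u (X i w)))%:E)%E =
  if cov u u == 0 then (f 0)%:E else
  (\int[normal_prob (lin_mean u) (Num.sqrt (cov u u))]_x
          (f (x - lin_mean u)%R)%:E)%E.
Proof.
move=> mf f0; set m := lin_mean u; set v := cov u u.
have mY : measurable_fun setT (fun w => (u^T *m col_of_tuple (X i w)) 0 0).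
  exact: (measurableT_comp (measurable_linear_form u) (measurable_funPT (X i))).
(* [normal_prob] lives on [measurableTypeR R], which has the same measurable
   sets as [R] but another display. *)
have mY' : @measurable_fun _ _ T (measurableTypeR R) setT
    (fun w => (u^T *m col_of_tuple (X i w)) 0 0) := mY.
pose Y : {mfun T >-> measurableTypeR R} :=
  @mfun_Sub _ _ T (measurableTypeR R) _ (mem_set mY').
have lawY A : measurable A -> distribution P Y A = normal_law m v A.
  by move=> mA; have [h _] := hX; exact: (h i u A mA).
have mfm : measurable_fun setT (fun y : measurableTypeR R => (f (y - m))%:E).
  apply/measurable_EFinP; apply: measurableT_comp => //.
  exact: measurable_funB.
transitivity (\int[distribution P Y]_y (f (y - m)%R)%:E)%E.
  rewrite ge0_integral_distribution //; last by move=> y; rewrite lee_fin.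
  by apply: eq_integral => w _; rewrite centered_formE.
case: ifP => v0.
  rewrite [LHS](eq_measure_integral (dirac (m : measurableTypeR R))); last first.
    by move=> A mA _; apply: etrans (lawY A mA) _; rewrite /normal_law v0.
  by rewrite integral_dirac // diracT mul1e subrr.
rewrite [LHS](eq_measure_integral (normal_prob m (Num.sqrt v))) //.
by move=> A mA _; apply: etrans (lawY A mA) _; rewrite /normal_law v0.
Qed.

Local Notation Y u i w := (centered_form u (X i w)).

Lemma has_mean_form2 u i : has_mean P (fun w => Y u i w ^+ 2) (cov u u).
Proof.
apply: ge0_has_mean.
- by apply: measurable_funX; exact: measurable_formX.
- by move=> w; rewrite sqr_ge0.
have mp : measurable_fun setT (fun y : R => y ^+ 2) by apply: measurable_funX.
have p0 (y : R) : 0 <= y ^+ 2 by rewrite sqr_ge0.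
rewrite (@integral_form u i _ mp p0).
case: eqVneq => [->|v0]; first by rewrite expr0n.
rewrite normal_prob_mom2 ?sqr_sqrtr ?cov_ge0 //.
by rewrite gt_eqF // sqrtr_gt0 lt_neqAle eq_sym v0 cov_ge0.
Qed.

Lemma has_mean_form4 u i :
  has_mean P (fun w => Y u i w ^+ 4) (3 * cov u u ^+ 2).
Proof.
apply: ge0_has_mean.
- by apply: measurable_funX; exact: measurable_formX.
- by move=> w; rewrite exprn_even_ge0.
have mp : measurable_fun setT (fun y : R => y ^+ 4) by apply: measurable_funX.
have p0 (y : R) : 0 <= y ^+ 4 by rewrite exprn_even_ge0.
rewrite (@integral_form u i _ mp p0).
case: eqVneq => [->|v0]; first by rewrite !expr0n mulr0.
rewrite normal_prob_mom4; first by rewrite (exprM _ 2 2) sqr_sqrtr ?cov_ge0.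
by rewrite gt_eqF // sqrtr_gt0 lt_neqAle eq_sym v0 cov_ge0.
Qed.

Lemma L4_form u i : L4 P (fun w => Y u i w).
Proof. by split; [exact: measurable_formX|eexists; exact: has_mean_form4]. Qed.

(** [integral_form] is about nonnegative functions, so the mean e is read off from squares: (1 + a
    Y)^2 has mean 1 + 2 a e + a^2 [cov u u], and reflection equates a = 1 with a = -1, which forces
    e = 0. *)
Lemma has_mean_form u i : has_mean P (fun w => Y u i w) 0.
Proof.
have [e he] := L4_mul4 (L4_form u i) (L4_cst P 1) (L4_cst P 1) (L4_cst P 1).
have {}he : has_mean P (fun w => Y u i w) e.
  by apply: eq_has_mean he => w; rewrite /cst !mulr1.
have q (a : R) : has_mean P (fun w => (1 + a * Y u i w) ^+ 2)
    (1 + 2 * a * e + a ^+ 2 * cov u u).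
  have := has_meanD (has_meanD (has_mean_cst P 1) (has_meanZ (2 * a) he))
    (has_meanZ (a ^+ 2) (has_mean_form2 u i)).
  by apply: eq_has_mean => w /=; ring.
have r : (\int[P]_w ((1 + 1 * Y u i w) ^+ 2)%:E =
    \int[P]_w ((1 + -1 * Y u i w) ^+ 2)%:E)%E.
  have mq (a : R) : measurable_fun setT (fun y : R => (1 + a * y) ^+ 2).
    by apply: measurable_funX; apply: measurable_funD => //; apply: measurable_funM.
  have q0 (a y : R) : 0 <= (1 + a * y) ^+ 2 by rewrite sqr_ge0.
  rewrite (@integral_form u i _ (mq 1) (q0 1)).
  rewrite (@integral_form u i _ (mq (-1)) (q0 (-1))).
  case: eqVneq => [_|v0]; first by rewrite !mulr0.
  under eq_integral do rewrite mul1r.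
  rewrite normal_prob_reflect.
    by apply: eq_integral => x _; rewrite mulN1r.
  by rewrite gt_eqF // sqrtr_gt0 lt_neqAle eq_sym v0 cov_ge0.
have [_ q1] := q 1; have [_ q2] := q (-1).
move: r; rewrite q1 q2 => -[] r.
suff -> : 0 = e by [].
lra.
Qed.

Lemma centered_formD u v x : centered_form (u + v) x = centered_form u x + centered_form v x.
Proof. by rewrite /centered_form [(u + v)^T]linearD mulmxDl mxE. Qed.

Lemma centered_formZ a u x : centered_form (a *: u) x = a * centered_form u x.
Proof. by rewrite /centered_form [(a *: u)^T]linearZ -scalemxAl mxE. Qed.

Lemma covC u v : cov u v = cov v u.
Proof.
have [sS _] := hS.
transitivity ((u^T *m Sigma *m v)^T 0 0); first by rewrite [RHS]mxE.
by rewrite 2!trmx_mul trmxK sS mulmxA.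
Qed.

Lemma covDl u v w : cov (u + v) w = cov u w + cov v w.
Proof. by rewrite /cov [(u + v)^T]linearD !mulmxDl mxE. Qed.

Lemma covZl a u w : cov (a *: u) w = a * cov u w.
Proof. by rewrite /cov [(a *: u)^T]linearZ -!scalemxAl mxE. Qed.

Lemma covDr u v w : cov w (u + v) = cov w u + cov w v.
Proof. by rewrite covC covDl !(covC w). Qed.

Lemma covZr a u w : cov w (a *: u) = a * cov w u.
Proof. by rewrite covC covZl (covC w). Qed.

(** Polarization: the product is a quarter of the difference of the squares of the forms u + v and u
    - v. *)
Lemma wick2_diag u v i :
  has_mean P (fun w => Y u i w * Y v i w) (cov u v).
Proof.
have q a := has_mean_form2 (u + a *: v) i.
have := has_meanZ 4^-1 (has_meanD (q 1) (has_meanZ (-1) (q (-1)))).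
have -> : 4^-1 * (cov (u + 1 *: v) (u + 1 *: v) +
    -1 * cov (u + -1 *: v) (u + -1 *: v)) = cov u v.
  by rewrite !(covDl, covDr, covZl, covZr) (covC v u); field.
by apply: eq_has_mean => w /=; rewrite !centered_formD !centered_formZ; field.
Qed.

Lemma wick4_diag u1 u2 u3 u4 i :
  has_mean P (fun w => Y u1 i w * Y u2 i w * Y u3 i w * Y u4 i w)
    (cov u1 u2 * cov u3 u4 + cov u1 u3 * cov u2 u4 + cov u1 u4 * cov u2 u3).
Proof.
pose s (a b c : R) := u1 + a *: u2 + b *: u3 + c *: u4.
(* 192 f1 f2 f3 f4 is the sum over signs a, b, c of
   a b c (f1 + a f2 + b f3 + c f4)^4. *)
have q a b c := has_meanZ (a * b * c) (has_mean_form4 (s a b c) i).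
have := has_meanZ 192^-1
  (has_meanD (has_meanD (has_meanD (q 1 1 1) (q 1 1 (-1)))
                        (has_meanD (q 1 (-1) 1) (q 1 (-1) (-1))))
             (has_meanD (has_meanD (q (-1) 1 1) (q (-1) 1 (-1)))
                        (has_meanD (q (-1) (-1) 1) (q (-1) (-1) (-1))))).
(* In the square of this expression the signed sum keeps only the products carrying the sign a b c,
   and these are the three pairings. *)
have cs a b c : cov (s a b c) (s a b c) =
    cov u1 u1 + a ^+ 2 * cov u2 u2 + b ^+ 2 * cov u3 u3 + c ^+ 2 * cov u4 u4 +
    2 * (a * cov u1 u2 + b * cov u1 u3 + c * cov u1 u4 + a * b * cov u2 u3 +
         a * c * cov u2 u4 + b * c * cov u3 u4).
  rewrite /s !(covDl, covDr, covZl, covZr) (covC u2 u1) (covC u3 u1) (covC u4 u1).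
  by rewrite (covC u3 u2) (covC u4 u2) (covC u4 u3); ring.
rewrite !cs => h.
have fs a b c w : Y (s a b c) i w =
    Y u1 i w + a * Y u2 i w + b * Y u3 i w + c * Y u4 i w.
  by rewrite /s !centered_formD !centered_formZ.
apply: (eq_has_mean (f := _) _ (e := _)); last first.
  move: h; congr (has_mean _ _ _); by field.
by move=> w /=; rewrite !fs; field.
Qed.

(** The factor at i1 has mean 0 and is independent of the other three together, whichever of their
    indices coincide. *)
Lemma wick4_alone u1 u2 u3 u4 i1 i2 i3 i4 :
  i2 != i1 -> i3 != i1 -> i4 != i1 ->
  has_mean P (fun w => Y u1 i1 w * Y u2 i2 w * Y u3 i3 w * Y u4 i4 w) 0.
Proof.
move=> n2 n3 n4; have [_ ind] := hX.
have [v hv] := L4_mul4 (L4_form u2 i2) (L4_form u3 i3) (L4_form u4 i4) (L4_cst P 1).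
have {}hv : has_mean P (fun w => Y u2 i2 w * Y u3 i3 w * Y u4 i4 w) v.
  by apply: eq_has_mean hv => w; rewrite /cst mulr1.
have mo u m : m != i1 ->
    measurable_fun [set: g_sigma_algebraType (off_cylinders X i1)]
    (fun w => Y u m w).
  move=> mi.
  have h := @measurable_fun_off_cylinders _ _ _ _ n X i1 m mi.
  exact: (measurableT_comp (measurable_form u) h).
have := @off_indep_has_meanM _ _ _ _ _ P n X ind i1 (centered_form u1) _ 0 v
  (measurable_form u1) _ (has_mean_form u1 i1) hv.
rewrite mul0r => h; apply: eq_has_mean (h _) => [w|] /=; first by rewrite !mulrA.
by apply: measurable_funM; [apply: measurable_funM|]; exact: mo.
Qed.

(** The pair at i is independent of the pair at j, which leaves two second moments. *)
Lemma wick4_pairs u1 u2 u3 u4 i j : j != i ->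
  has_mean P (fun w => Y u1 i w * Y u2 i w * Y u3 j w * Y u4 j w)
    (cov u1 u2 * cov u3 u4).
Proof.
move=> ji; have [_ ind] := hX.
have mo u : measurable_fun [set: g_sigma_algebraType (off_cylinders X i)]
    (fun w => Y u j w).
  have h := @measurable_fun_off_cylinders _ _ _ _ n X i j ji.
  exact: (measurableT_comp (measurable_form u) h).
have := @off_indep_has_meanM _ _ _ _ _ P n X ind i
  (fun x => centered_form u1 x * centered_form u2 x) _ _ _ _ _
  (wick2_diag u1 u2 i) (wick2_diag u3 u4 j).
move=> h; apply: eq_has_mean (h _ _) => [w||] /=; first by rewrite !mulrA.
- by apply: measurable_funM; exact: measurable_form.
- by apply: measurable_funM; exact: mo.
Qed.

(** If no index occurs exactly once, the indices are all equal or form two pairs, as in [wick4_diag]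
    and [wick4_pairs]. Otherwise an index occurring once is moved to the front, and [wick4_alone]
    gives 0. *)
Lemma wick4 u1 u2 u3 u4 i1 i2 i3 i4 :
  has_mean P (fun w => Y u1 i1 w * Y u2 i2 w * Y u3 i3 w * Y u4 i4 w)
    ((i1 == i2)%:R * (i3 == i4)%:R * (cov u1 u2 * cov u3 u4) +
     (i1 == i3)%:R * (i2 == i4)%:R * (cov u1 u3 * cov u2 u4) +
     (i1 == i4)%:R * (i2 == i3)%:R * (cov u1 u4 * cov u2 u3)).
Proof.
have [<-|n12] := eqVneq i1 i2.
  have [<-|n34] := eqVneq i3 i4.
    have [<-|n13] := eqVneq i1 i3.
      by rewrite !mul1r; exact: wick4_diag.
    by rewrite !mul0r !addr0 !mul1r; apply: wick4_pairs; rewrite eq_sym.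
  rewrite !mulr0 !mul0r add0r.
  have [e13|n13] := eqVneq i1 i3.
    have n14 : i1 != i4 by rewrite e13.
    rewrite (negbTE n14) mulr0 !mul0r addr0.
    (* The first three indices are equal here, and i4 is alone. *)
    have := @wick4_alone u4 u1 u2 u3 i4 i1 i1 i3 n14 n14 n34.
    by apply: eq_has_mean => w /=; ring.
  rewrite !mul0r mulr0 mul0r addr0.
  (* Here i3 differs from i1 = i2 and from i4. *)
  have := @wick4_alone u3 u1 u2 u4 i3 i1 i1 i4 n13 n13 _.
  rewrite eq_sym => /(_ n34).
  by apply: eq_has_mean => w /=; ring.
rewrite !mul0r add0r.
have [e13|n13] := eqVneq i1 i3.
  have n23 : i2 != i3 by rewrite -e13 eq_sym.
  rewrite (negbTE n23) mulr0 mul0r addr0 mul1r.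
  have [<-|n24] := eqVneq i2 i4.
    rewrite mul1r -e13; have := @wick4_pairs u1 u3 u2 u4 i1 i2 _.
    rewrite eq_sym => /(_ n12).
    by apply: eq_has_mean => w /=; ring.
  rewrite mul0r; have := @wick4_alone u2 u1 u3 u4 i2 i1 i3 i4 n12 _ _.
  rewrite eq_sym n23 eq_sym n24 => /(_ isT isT).
  by apply: eq_has_mean => w /=; ring.
rewrite !mul0r add0r.
have [e14|n14] := eqVneq i1 i4.
  have [e23|n23] := eqVneq i2 i3.
    rewrite !mul1r -e14 -e23; have := @wick4_pairs u1 u4 u2 u3 i1 i2 _.
    rewrite eq_sym => /(_ n12).
    by apply: eq_has_mean => w /=; ring.
  rewrite mulr0 mul0r; have := @wick4_alone u2 u1 u3 u4 i2 i1 i3 i4 n12 _ _.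
  rewrite -e14 n12 eq_sym n23 => /(_ isT isT).
  by apply: eq_has_mean => w /=; ring.
by rewrite !mul0r; apply: wick4_alone; rewrite eq_sym.
Qed.

Lemma wick2 u v i j :
  has_mean P (fun w => Y u i w * Y v j w) ((i == j)%:R * cov u v).
Proof.
have [<-|nij] := eqVneq i j; first by rewrite mul1r; exact: wick2_diag.
rewrite mul0r; have [_ ind] := hX.
have := @off_indep_has_meanM _ _ _ _ _ P n X ind i (centered_form u) _ 0 0
  (measurable_form u) _ (has_mean_form u i) (has_mean_form v j).
rewrite mul0r; apply; rewrite eq_sym in nij.
have h := @measurable_fun_off_cylinders _ _ _ _ n X i j nij.
exact: (measurableT_comp (measurable_form v) h).
Qed.

End normal_sample.

(** * Traces and symmetry of the pseudoinverse; a covariance of given rank *)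

Section pseudoinverse.
Variables (R : realType) (p : nat).
Implicit Types A S : 'M[R]_p.

(** In a rank factorization A = C D, the outer factors cancel from C D C D = C D, leaving D C = 1,
    whose trace is the rank. *)
Lemma mxtrace_idem A : A *m A = A -> \tr A = (\rank A)%:R.
Proof.
move=> AA; have := mulmx_base A.
move: (col_base A) (row_base A) (col_base_full A) (row_base_free A).
move=> C D fC fD CD.
have DC : D *m C = 1%:M.
  apply: (row_free_inj fD); rewrite mul1mx.
  by apply: (row_full_inj fC); rewrite !mulmxA CD -mulmxA CD AA.
by rewrite -{1}CD mxtrace_mulC DC mxtrace1.
Qed.

(** By the first Penrose equation the product is idempotent and has the rank of A. *)
Lemma mxtrace_mul_pinv A : \tr (A *m Defs.pinv A) = (\rank A)%:R.
Proof.
have [h1 h2 _ _] := Defs.pinvP A.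
rewrite mxtrace_idem; last by rewrite mulmxA h1.
congr (_%:R); apply/eqP; rewrite eqn_leq mxrankM_maxl /=.
by rewrite -{1}h1 mxrankM_maxl.
Qed.

(** The transpose of the pseudoinverse solves the same four Penrose equations. *)
Lemma pinv_sym S : S^T = S -> (Defs.pinv S)^T = Defs.pinv S.
Proof.
move=> sS; have := Defs.pinvP S; move: (Defs.pinv S) => M hM.
have [h1 h2 h3 h4] := hM; apply: (is_pinv_uniq (A := S)) hM.
have tE : S *m M^T = M *m S by rewrite -h4 trmx_mul sS.
have tE' : M^T *m S = S *m M by rewrite -h3 trmx_mul sS.
split.
- by have := congr1 trmx h1; rewrite !trmx_mul sS mulmxA.
- by have := congr1 trmx h2; rewrite !trmx_mul sS mulmxA.
- by rewrite trmx_mul trmxK sS tE.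
- by rewrite trmx_mul trmxK sS tE'.
Qed.

(** This is the parameter at which [dominates] gets its strict inequality. The matrix E satisfies E
    = E E^T, hence is positive semidefinite. *)
Lemma covariance_of_rank_pid r : (r <= p)%N ->
  covariance_of_rank r (pid_mx r : 'M[R]_p).
Proof.
move=> rp; split; last by rewrite rank_pid_mx.
split; first exact: tr_pid_mx.
move=> u; have -> : (pid_mx r : 'M[R]_p) = pid_mx r *m (pid_mx r : 'M[R]_p)^T.
  by rewrite tr_pid_mx pid_mx_id.
rewrite mulmxA -mulmxA -{2}[u]trmxK -trmx_mul.
rewrite mxE sumr_ge0 // => k _; rewrite [X in _ * X]mxE -expr2; exact: sqr_ge0.
Qed.

End pseudoinverse.

(** * The centring matrix and the sample covariance *)

Section centering.
Variables (R : realType) (n p : nat).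
Hypothesis n_gt0 : (0 < n)%N.

Definition centering (i j : 'I_n) : R := (i == j)%:R - n%:R^-1.

Let n0 : n%:R != 0 :> R.
Proof. by rewrite pnatr_eq0 -lt0n. Qed.

Lemma sum_delta (F : 'I_n -> R) i : \sum_j (i == j)%:R * F j = F i.
Proof.
rewrite (bigD1 i) //= eqxx mul1r big1 ?addr0 // => j ji.
by rewrite eq_sym (negbTE ji) mul0r.
Qed.

Lemma centering_sym i j : centering i j = centering j i.
Proof. by rewrite /centering eq_sym. Qed.

Lemma sum_centering_diag : \sum_i centering i i = n%:R - 1.
Proof.
under eq_bigr do rewrite /centering eqxx.
by rewrite sumr_const card_ord -[LHS]mulr_natr mulrBl mul1r mulVf.
Qed.

(** The matrix is a symmetric idempotent, so the squares in row i sum to its diagonal entry. *)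
Lemma sum_centering_sqr : \sum_i \sum_j centering i j ^+ 2 = n%:R - 1.
Proof.
rewrite -sum_centering_diag; apply: eq_bigr => i _.
have -> : \sum_j centering i j ^+ 2 =
    \sum_j ((i == j)%:R * (1 - 2 / n%:R) + n%:R ^- 2).
  apply: eq_bigr => j _; rewrite /centering; case: eqP => _ /=; first by field.
  by rewrite sub0r sqrrN mul0r add0r exprVn.
rewrite big_split /= sum_delta sumr_const card_ord /centering eqxx.
rewrite -[n%:R ^- 2 *+ n]mulr_natr /=; move: n%:R n0 => x x0.
by field.
Qed.

(** Wick's three pairings are contracted with two copies of the matrix: (ij)(kl) gives the square of
    its trace, (ik)(jl) and (il)(jk) the trace of its square. *)
Lemma sum4_centering (q A B C : R) :
  \sum_(i < n) \sum_(j < n) \sum_(k < n) \sum_(l < n)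
    q * (centering i j * centering k l) *
    ((i == j)%:R * (k == l)%:R * A + (i == k)%:R * (j == l)%:R * B +
     (i == l)%:R * (j == k)%:R * C) =
  q * ((n%:R - 1) ^+ 2 * A + (n%:R - 1) * B + (n%:R - 1) * C).
Proof.
pose c := centering.
have sl i j k : \sum_l q * (c i j * c k l) *
    ((i == j)%:R * (k == l)%:R * A + (i == k)%:R * (j == l)%:R * B +
     (i == l)%:R * (j == k)%:R * C) =
    (i == j)%:R * (q * c i j * A) * c k k + (i == k)%:R * (q * c i j * B * c k j) +
    (j == k)%:R * (q * c i j * C * c k i).
  rewrite -(sum_delta (c k) k) -(sum_delta (fun l => q * c i j * B * c k l) j).
  rewrite -(sum_delta (fun l => q * c i j * C * c k l) i) !mulr_sumr -!big_split /=.
  by apply: eq_bigr => l _; ring.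
have sk i j : \sum_k ((i == j)%:R * (q * c i j * A) * c k k +
      (i == k)%:R * (q * c i j * B * c k j) + (j == k)%:R * (q * c i j * C * c k i)) =
    (i == j)%:R * (q * c i j * A * (n%:R - 1)) + q * (B + C) * c i j ^+ 2.
  rewrite !big_split /= -mulr_sumr sum_centering_diag.
  rewrite (sum_delta (fun k => q * c i j * B * c k j)).
  rewrite (sum_delta (fun k => q * c i j * C * c k i)).
  by rewrite /c (centering_sym j i); ring.
transitivity (\sum_(i < n) \sum_(j < n)
    ((i == j)%:R * (q * c i j * A * (n%:R - 1)) + q * (B + C) * c i j ^+ 2)).
  apply: eq_bigr => i _; apply: eq_bigr => j _; rewrite -sk.
  by apply: eq_bigr => k _; rewrite -sl.
transitivity (\sum_(i < n) (q * A * (n%:R - 1) * c i i +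
    q * (B + C) * \sum_(j < n) c i j ^+ 2)).
  apply: eq_bigr => i _.
  rewrite big_split /= (sum_delta (fun j => q * c i j * A * (n%:R - 1))) -mulr_sumr.
  by congr (_ + _); ring.
by rewrite big_split /= -!mulr_sumr sum_centering_diag sum_centering_sqr; ring.
Qed.

(** Centring removes any common shift, so [mu] is arbitrary here; the true mean turns the summands
    into products of centred forms. *)
Lemma sample_cov_centering (x : 'I_n -> 'cV[R]_p) (mu : 'cV[R]_p) :
  sample_cov x = \sum_i \sum_j
    (n%:R^-1 * centering i j) *: ((x i - mu) *m (x j - mu)^T).
Proof.
rewrite /sample_cov scaler_sumr.
pose y i := x i - mu; pose s := \sum_i y i.
have xs i : x i - sample_mean x = y i - n%:R^-1 *: s.
  have -> : s = \sum_i x i - n%:R *: mu.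
    by rewrite /s /y sumrB sumr_const card_ord scaler_nat.
  by rewrite scalerBr scalerA mulVf // scale1r opprB addrA subrK.
under eq_bigr do rewrite xs.
(* The cross terms add up to -2 s s^T / n, and the n squares to s s^T / n. *)
transitivity (n%:R^-1 *: (\sum_i y i *m (y i)^T - n%:R^-1 *: (s *m s^T))).
  rewrite -scaler_sumr; congr (_ *: _).
  have expand (z : 'cV[R]_p) a : (z - a *: s) *m (z - a *: s)^T =
      z *m z^T - a *: (z *m s^T) - a *: (s *m z^T) + (a * a) *: (s *m s^T).
    rewrite [(z - a *: s)^T]linearB /= [(a *: s)^T]linearZ /=.
    rewrite mulmxBl !mulmxBr -!scalemxAl -!scalemxAr scalerA opprB.
    by rewrite [a * a *: _ - _]addrC addrA.
  under eq_bigr do rewrite expand.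
  rewrite big_split /= !sumrB -!scaler_sumr -mulmx_suml -mulmx_sumr -/s.
  have -> : \sum_i (y i)^T = s^T by rewrite /s linear_sum.
  have aan : (n%:R^-1 * n%:R^-1) *+ n = n%:R^-1 :> R.
    by rewrite -[LHS]mulr_natr mulfVK.
  by rewrite sumr_const card_ord -scalerMnr scalerMnl aan subrK.
have -> : s *m s^T = \sum_i \sum_j y i *m (y j)^T.
  by rewrite {1}/s mulmx_suml; apply: eq_bigr => i _; rewrite linear_sum mulmx_sumr.
rewrite scaler_sumr -sumrB scaler_sumr; apply: eq_bigr => i _.
rewrite scaler_sumr.
have -> : y i *m (y i)^T = \sum_j (i == j)%:R *: (y i *m (y j)^T).
  rewrite (bigD1 i) //= eqxx scale1r big1 ?addr0 // => j ji.
  by rewrite eq_sym (negbTE ji) scale0r.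
rewrite -sumrB scaler_sumr; apply: eq_bigr => j _.
by rewrite -scalerBl scalerA.
Qed.

End centering.

(** * The mean loss of a multiple of the sample covariance *)

Section risk.
Context d (T : measurableType d) (R : realType) (P : probability T R).
Variables (n p r : nat) (X : 'I_n -> {mfun T >-> p.-tuple R}).
Variables (mu : 'cV[R]_p) (Sigma : 'M[R]_p).
Hypothesis n_gt0 : (0 < n)%N.
Hypothesis hX : iid_mvnormal P X mu Sigma.
Hypothesis hSr : covariance_of_rank r Sigma.

Let hS : psd Sigma. Proof. by case: hSr. Qed.
Let sS : Sigma^T = Sigma. Proof. by case: hS. Qed.
Let M := Defs.pinv Sigma.
Let n0 : n%:R != 0 :> R.
Proof. by rewrite pnatr_eq0 -lt0n. Qed.

Let e (a : 'I_p) : 'cV[R]_p := delta_mx a 0.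
Let m (b : 'I_p) : 'cV[R]_p := col b M.

(** The loss of a multiple of S depends on the sample only through this matrix. *)
Definition whitened (w : T) : 'M[R]_p :=
  sample_cov (fun i => col_of_tuple (X i w)) *m M.

Let F (u : 'cV[R]_p) (i : 'I_n) (w : T) : R := centered_form mu u (X i w).

Let tr_delta_mulmx q (A : 'M[R]_(p, q)) a j : ((e a)^T *m A) 0 j = A a j.
Proof. by rewrite /e trmx_delta -rowE mxE. Qed.

(** Entry (a, b) of Y_i Y_j^T M is the form e_a in Y_i times the form m_b in Y_j, where m_b is
    column b of M. *)
Lemma whitenedE w a b : whitened w a b =
  \sum_i \sum_j n%:R^-1 * centering R i j * (F (e a) i w * F (m b) j w).
Proof.
rewrite /whitened (sample_cov_centering n_gt0 _ mu) mulmx_suml summxE.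
apply: eq_bigr => i _; rewrite mulmx_suml summxE; apply: eq_bigr => j _.
rewrite -scalemxAl mxE -mulmxA mxE big_ord1; congr (_ * (_ * _)).
  by rewrite /F /centered_form tr_delta_mulmx.
rewrite /F /centered_form /m colE trmx_mul -mulmxA tr_delta_mulmx.
by rewrite -[in RHS](trmxK (_ - mu)) -trmx_mul [RHS]mxE.
Qed.

Lemma cov_ee a b : cov Sigma (e a) (e b) = Sigma a b.
Proof. by rewrite /cov -mulmxA tr_delta_mulmx /e -colE mxE. Qed.

Lemma cov_em a b : cov Sigma (e a) (m b) = (Sigma *m M) a b.
Proof. by rewrite /cov -mulmxA tr_delta_mulmx /m colE mulmxA -colE mxE. Qed.

(** M is symmetric, and M Sigma M = M is the second Penrose equation. *)
Lemma cov_mm a b : cov Sigma (m a) (m b) = M a b.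
Proof.
have [_ h2 _ _] := Defs.pinvP Sigma.
rewrite /cov /m !colE trmx_mul (pinv_sym sS) -/M -!mulmxA tr_delta_mulmx.
by rewrite !mulmxA h2 -colE mxE.
Qed.


Lemma has_mean_whitened a b :
  has_mean P (fun w => whitened w a b)
    ((n%:R - 1) / n%:R * (Sigma *m M) a b).
Proof.
have := has_mean_sum (index_enum 'I_n) (fun i => has_mean_sum (index_enum 'I_n)
  (fun j => has_meanZ (n%:R^-1 * centering R i j) (wick2 hX hS (e a) (m b) i j))).
have -> : \sum_(i < n) \sum_(j < n)
      n%:R^-1 * centering R i j * ((i == j)%:R * cov Sigma (e a) (m b)) =
    (n%:R - 1) / n%:R * (Sigma *m M) a b.
  rewrite cov_em -(sum_centering_diag R n_gt0) !mulr_suml; apply: eq_bigr => i _.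
  rewrite -(sum_delta (fun j => centering R i j / n%:R * (Sigma *m M) a b) i).
  by apply: eq_bigr => j _; ring.
by apply: eq_has_mean => w; rewrite whitenedE.
Qed.

(** The three terms are the pairings (e_a m_b)(e_b m_a), (e_a e_b)(m_b m_a) and (e_a m_a)(m_b e_b),
    weighted by [sum4_centering]. *)
Lemma has_mean_whitened_mul a b :
  has_mean P (fun w => whitened w a b * whitened w b a)
    (n%:R ^- 2 * ((n%:R - 1) ^+ 2 * ((Sigma *m M) a b * (Sigma *m M) b a) +
      (n%:R - 1) * (Sigma a b * M b a) +
      (n%:R - 1) * ((Sigma *m M) a a * (Sigma *m M) b b))).
Proof.
pose c := centering R (n := n).
have := has_mean_sum (index_enum 'I_n) (fun i => has_mean_sum (index_enum 'I_n)
  (fun j => has_mean_sum (index_enum 'I_n) (fun k => has_mean_sum (index_enum 'I_n)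
  (fun l => has_meanZ (n%:R ^- 2 * (c i j * c k l))
    (wick4 hX hS (e a) (m b) (e b) (m a) i j k l))))).
set E := (X in has_mean _ _ X).
suff -> : E = n%:R ^- 2 * ((n%:R - 1) ^+ 2 * ((Sigma *m M) a b * (Sigma *m M) b a) +
      (n%:R - 1) * (Sigma a b * M b a) +
      (n%:R - 1) * ((Sigma *m M) a a * (Sigma *m M) b b)).
  apply: eq_has_mean => w; rewrite !whitenedE.
  rewrite [RHS]mulr_suml; apply: eq_bigr => i _.
  rewrite [RHS]mulr_suml; apply: eq_bigr => j _.
  rewrite [RHS]mulr_sumr; apply: eq_bigr => k _.
  rewrite [RHS]mulr_sumr; apply: eq_bigr => l _.
  by rewrite /F /c; field.
rewrite {}/E !cov_em cov_ee cov_mm (covC hS (m b)) cov_em.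
exact: sum4_centering.
Qed.

Lemma tr_SigmaM : \tr (Sigma *m M) = r%:R.
Proof. by case: hSr => _ <-; exact: mxtrace_mul_pinv. Qed.

Lemma mxtrace_mul_sum q (A B : 'M[R]_q) :
  \tr (A *m B) = \sum_a \sum_b A a b * B b a.
Proof. by apply: eq_bigr => a _; rewrite mxE. Qed.

Lemma has_mean_tr_whitened :
  has_mean P (fun w => \tr (whitened w)) ((n%:R - 1) * r%:R / n%:R).
Proof.
have := has_mean_sum (index_enum 'I_p) (fun a => has_mean_whitened a a).
by rewrite -mulr_sumr -/(mxtrace _) tr_SigmaM mulrAC.
Qed.

(** Up to the factor n^-2, the three terms sum over a and b to (n-1)^2 r, (n-1) r and (n-1) r^2,
    because tr(Sigma M Sigma M) = tr(Sigma M) = r. *)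
Lemma has_mean_tr_whitened_sqr :
  has_mean P (fun w => \tr (whitened w *m whitened w))
    ((n%:R - 1) * r%:R * (n%:R + r%:R) / n%:R ^+ 2).
Proof.
have := has_mean_sum (index_enum 'I_p) (fun a =>
  has_mean_sum (index_enum 'I_p) (fun b => has_mean_whitened_mul a b)).
set E := (X in has_mean _ _ X).
suff -> : E = (n%:R - 1) * r%:R * (n%:R + r%:R) / n%:R ^+ 2.
  by apply: eq_has_mean => w; rewrite mxtrace_mul_sum.
rewrite {}/E; under eq_bigr do rewrite -mulr_sumr !big_split /= -!mulr_sumr.
rewrite -mulr_sumr !big_split /= -!mulr_sumr -!mxtrace_mul_sum.
have [h1 _ _ _] := Defs.pinvP Sigma.
rewrite mulmxA h1 tr_SigmaM -mulr_suml -!/(mxtrace _) tr_SigmaM.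
by field.
Qed.

(** With K = [whitened w], the loss expands to a^2 tr(K^2) - 2 a tr(K) + p. *)
Lemma has_mean_loss a :
  has_mean P (fun w => loss (a *: sample_cov (fun i => col_of_tuple (X i w))) Sigma)
   (p%:R + (n%:R - 1) * r%:R / n%:R ^+ 2 * ((n%:R + r%:R) * a ^+ 2 - 2 * n%:R * a)).
Proof.
have := has_meanD (has_mean_cst P p%:R) (has_meanD
  (has_meanZ (a ^+ 2) has_mean_tr_whitened_sqr)
  (has_meanZ (- 2 * a) has_mean_tr_whitened)).
set E := (X in has_mean _ _ X).
suff -> : E = p%:R + (n%:R - 1) * r%:R / n%:R ^+ 2 *
    ((n%:R + r%:R) * a ^+ 2 - 2 * n%:R * a).
  apply: eq_has_mean => w; rewrite /loss -scalemxAl -/M -/(whitened w).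
  move: (whitened w) => K; rewrite expr2 -[RHS]/(\tr ((_ - _) *m (_ - _))).
  rewrite mulmxBl !mulmxBr !mul1mx mulmx1 -!scalemxAl -!scalemxAr.
  by rewrite !linearB /= !linearZ /= mxtrace1 /cst /GRing.scale /=; ring.
by rewrite /E; field.
Qed.

End risk.

(** * Minimizing and comparing the risks as a quadratic function of the multiple *)

Theorem proposition1 (R : realType) (n p r : nat)
    (hr : (1 <= r <= n - 1)%N) (hrnp : (r < minn n p)%N)
    (d : measure_display) (T : measurableType d)
    (P : 'cV[R]_p -> 'M[R]_p -> probability T R)
    (X : 'I_n -> {mfun T >-> p.-tuple R})
    (hmodel : normal_model P X r) :
  let S : estimator R n p := @sample_cov R n p in
  let HF1 : estimator R n p := scaled_cov (n%:R / (n%:R + r%:R)) in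
  [/\ forall (mu : 'cV[R]_p) (Sigma : 'M[R]_p), covariance_of_rank r Sigma ->
        [/\ forall a : R,
              (risk P X HF1 mu Sigma <= risk P X (scaled_cov a) mu Sigma)%E,
            forall a : R,
              risk P X (scaled_cov a) mu Sigma = risk P X HF1 mu Sigma ->
              a = n%:R / (n%:R + r%:R)
          & risk P X HF1 mu Sigma =
              (p%:R - (n%:R - 1) * r%:R / (n%:R + r%:R))%:E],
      dominates P X r HF1 S
    & dominates P X r S (scaled_cov (n%:R / (n%:R - 1)))].
Proof.
move=> S HF1.
have [r1 rn] := andP hr.
have rp : (r <= p)%N by move: hrnp; rewrite leq_min => /andP[_ /ltnW].
have n1 : (1 < n)%N by lia.
have n_gt0 : (0 < n)%N by lia.
have R0 : (0 : R) < r%:R by rewrite ltr0n.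
have N1 : (0 : R) < n%:R - 1 by rewrite subr_gt0 ltr1n.
have N0 : (0 : R) < n%:R by rewrite ltr0n.
have NR : (0 : R) < n%:R + r%:R by rewrite addr_gt0.
(* The mean loss is written as a completed square [rho], with leading coefficient k > 0 and vertex
   a0. *)
pose k : R := (n%:R - 1) * r%:R / n%:R ^+ 2 * (n%:R + r%:R).
have k0 : 0 < k by rewrite !mulr_gt0 ?invr_gt0 ?exprn_gt0.
pose a0 : R := n%:R / (n%:R + r%:R).
pose rho (a : R) : R :=
  p%:R - (n%:R - 1) * r%:R / (n%:R + r%:R) + k * (a - a0) ^+ 2.
have riskE mu Sigma a : covariance_of_rank r Sigma ->
    risk P X (scaled_cov a) mu Sigma = (rho a)%:E.
  move=> hS; rewrite /risk unlock /scaled_cov.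
  have [_ ->] := has_mean_loss n_gt0 (hmodel mu Sigma hS) hS a; congr EFin.
  by rewrite /rho /k /a0; field; rewrite !gt_eqF.
have S1 : S = scaled_cov 1 by apply/funext => x; rewrite /scaled_cov scale1r.
have rho_min a : rho a0 <= rho a.
  by rewrite /rho subrr expr0n /= mulr0 lerD2l mulr_ge0 ?sqr_ge0 ?ltW.
have dom a b : rho a < rho b -> dominates P X r (scaled_cov a) (scaled_cov b).
  move=> ab; split=> [mu Sigma hS|].
    by rewrite !riskE // lee_fin ltW.
  (* The risk is the same at all parameters of rank r, so any one of them shows strictness. *)
  exists 0, (pid_mx r); have hS := covariance_of_rank_pid R rp.
  by split => //; rewrite !riskE // lte_fin.
have a01 : a0 < 1 by rewrite /a0 ltr_pdivrMr // mul1r ltrDl.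
have a11 : 1 < n%:R / (n%:R - 1) :> R by rewrite ltr_pdivlMr // mul1r ltrBlDr ltrDl.
(* Right of its vertex [rho] increases, and a0 < 1 < n / (n - 1) are the multiples to compare. *)
have rho_mono a b : a0 <= a -> a < b -> rho a < rho b.
  move=> h1 h2; rewrite /rho ltrD2l ltr_pM2l //.
  by rewrite ltr_pXn2r ?nnegrE ?subr_ge0 ?ltrD2r // ltW // (le_lt_trans h1).
split.
- move=> mu Sigma hS; split=> [a|a|].
  + by rewrite !riskE // lee_fin; exact: rho_min.
  + rewrite !riskE // => -[]; rewrite /rho subrr expr0n /= mulr0 => /addrI /eqP.
    by rewrite mulf_eq0 gt_eqF //= sqrf_eq0 subr_eq0 => /eqP.
  + by rewrite riskE // /rho subrr expr0n /= mulr0 addr0.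
- by rewrite S1; apply: dom; exact: rho_mono.
- by rewrite S1; apply: dom; apply: rho_mono => //; exact: ltW.
Qed.
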